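(* Let $n\ge2$ and $1\le k\le n-1$ be integers, and define \[ C_{n,k}^{\rm loc}=\min_{1\le m\le n-1}\frac{|\lambda_{m,k}|^2-k\operatorname{Re}\lambda_{m,k}}{k^3},\qquad \lambda_{m,k}=\sum_{j=1}^k e^{2\pi \mathrm{i} mj/n}. \] Then the following hold. (i) If $C_{n,k}^{\rm loc}>0$, then the equal point is a strict local minimum of $S_{n,k}$ modulo scaling. More precisely, for every $\varepsilon>0$ there is a neighbourhood of the equal point such that for all $x$ in it \[ S_{n,k}(x)-\frac nk\ \ge\ \left(C_{n,k}^{\rm loc}-\varepsilon\right)\sum_{i=1}^n\left(\log x_i-\overline{\log x}\right)^2 . \] (ii) If $C_{n,k}^{\rm loc}<0$, then the equal point is a saddle of $S_{n,k}$. In particular, there are positive vectors $x$ arbitrarily close to the equal point such that $S_{n,k}(x)<\frac nk$. (iii) If $C_{n,k}^{\rm loc}=0$, then there is no positive quadratic stability constant at the equal point, i.e. there do not exist $c>0$ and a neighbourhood of the equal point on which $S_{n,k}(x)-\frac nk\ge c\sum_{i=1}^n\left(\log x_i-\overline{\log x}\right)^2$.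
   Context: For $x=(x_1,\dots,x_n)$ with all $x_i>0$ and indices modulo $n$, \[ S_{n,k}(x)=\sum_{i=1}^n\frac{x_i}{x_{i+1}+\cdots+x_{i+k}},\qquad \overline{\log x}=\frac1n\sum_{i=1}^n\log x_i . \] $S_{n,k}$ is homogeneous of degree $0$. The equal point is $x=(1,\dots,1)$ (considered up to common scaling); there $S_{n,k}=n/k$. ''Strict local minimum modulo scaling'' means: there is a neighbourhood $U$ of $(1,\dots,1)$ in the positive orthant such that $S_{n,k}(x)>n/k$ for every $x\in U$ that is not a constant vector. ''Saddle'' means: the equal point is a critical point of $S_{n,k}$ and every neighbourhood of it contains positive vectors with $S_{n,k}<n/k$ and positive vectors with $S_{n,k}>n/k$. *)

(* Defs.v *)
From mathcomp Require Import all_boot all_order all_algebra.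
From mathcomp Require Import all_classical all_reals all_analysis.
From mathcomp.real_closed Require Import complex.

Set Implicit Arguments.
Unset Strict Implicit.
Unset Printing Implicit Defensive.

Import Order.TTheory GRing.Theory Num.Theory.
Import numFieldNormedType.Exports.

Local Open Scope classical_set_scope.
Local Open Scope ring_scope.

(* The coordinates x_1, ..., x_n are indexed by 'I_n, i.e. by 0, ..., n-1. *)
Fact cshift_subproof n (i : 'I_n) (j : nat) : ((i + j) %% n < n)%N.
Proof. by rewrite ltn_mod (leq_ltn_trans (leq0n i) (ltn_ord i)). Qed.

Definition cshift n (i : 'I_n) (j : nat) : 'I_n := Ordinal (cshift_subproof i j).

Definition cyc_sum (R : realType) (n k : nat) (x : 'rV[R]_n) : R :=
  \sum_(i < n) x ord0 i / \sum_(1 <= j < k.+1) x ord0 (cshift i j).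

Definition mean_log (R : realType) (n : nat) (x : 'rV[R]_n) : R :=
  n%:R^-1 * \sum_(i < n) ln (x ord0 i).

Definition log_dev (R : realType) (n : nat) (x : 'rV[R]_n) : R :=
  \sum_(i < n) (ln (x ord0 i) - mean_log x) ^+ 2.

Definition expi (R : realType) (t : R) : R[i] := Complex (cos t) (sin t).

Definition lambda_ (R : realType) (n m k : nat) : R[i] :=
  \sum_(1 <= j < k.+1) expi (2 * pi * (m * j)%:R / n%:R : R).

Definition loc_ratio (R : realType) (n k m : nat) : R :=
  (ComplexField.Normc.normc (lambda_ R n m k) ^+ 2
     - k%:R * complex.Re (lambda_ R n m k)) / k%:R ^+ 3.

(* For n >= 2 the initial value of the iterated minimum is the term m = 1 of
   the range, so this is exactly the minimum over 1 <= m <= n-1. *)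
Definition Cloc (R : realType) (n k : nat) : R :=
  \big[Num.min/loc_ratio R n k 1]_(1 <= m < n) loc_ratio R n k m.

Definition pos_orthant (R : realType) (n : nat) : set 'rV[R]_n :=
  [set x | forall i, 0 < x ord0 i].

Definition equal_pt (R : realType) (n : nat) : 'rV[R]_n := const_mx 1.

(* Neighbourhoods are taken in the positive orthant. *)
Definition strict_local_min_mod_scaling (R : realType) (n k : nat) : Prop :=
  \forall x \near within (@pos_orthant R n) (nbhs (equal_pt R n)),
    (~ exists c : R, x = const_mx c) -> n%:R / k%:R < cyc_sum k x.

Definition critical_pt (R : realType) (n : nat) (f : 'rV[R]_n -> R)
    (a : 'rV[R]_n) : Prop :=
  differentiable f a /\ forall v, 'd f a v = 0.

Definition has_below_near (R : realType) (n k : nat) : Prop :=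
  forall U : set 'rV[R]_n, nbhs (equal_pt R n) U ->
    exists x, [/\ U x, pos_orthant x & cyc_sum k x < n%:R / k%:R].

Definition has_above_near (R : realType) (n k : nat) : Prop :=
  forall U : set 'rV[R]_n, nbhs (equal_pt R n) U ->
    exists x, [/\ U x, pos_orthant x & n%:R / k%:R < cyc_sum k x].

Definition saddle (R : realType) (n k : nat) : Prop :=
  [/\ critical_pt (@cyc_sum R n k) (equal_pt R n),
      has_below_near R n k & has_above_near R n k].

Definition quadratic_bound_near (R : realType) (n k : nat) (c : R) : Prop :=
  \forall x \near within (@pos_orthant R n) (nbhs (equal_pt R n)),
    c * log_dev x <= cyc_sum k x - n%:R / k%:R.

(* Main.v *)
(* Write x_i = mu + h_i and s_i = h_(i+1) + ... + h_(i+k). Since the linear terms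
   cancel, S(x) - n/k equals the sum of s_i (s_i - k h_i) / (k^2 mu D_i), with D_i
   the i-th denominator of S; near the equal point this is the cyclic quadratic
   form sum s_i (s_i - k h_i) / k^3 up to an error O(|x - 1| |h|^2). The discrete
   Fourier transform diagonalises this form with eigenvalues
   (|lambda_m|^2 - k Re lambda_m) / k^3. For the lower bound mu is the mean of x,
   which removes the frequency m = 0; negative or degenerate directions are real
   and imaginary parts of the characters. Logarithms enter only through the
   comparison of sum (log x_i - mean)^2 with sum h_i^2, up to a factor tending
   to 1. *)
Require Import Defs.
From mathcomp Require Import all_boot all_order all_algebra.
From mathcomp Require Import all_classical all_reals all_analysis.
From mathcomp.real_closed Require Import complex.
From mathcomp Require Import ring lra.

Import Order.TTheory GRing.Theory Num.Theory.
Import numFieldNormedType.Exports.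
Local Open Scope ring_scope.

(** * Forward sums, the cyclic form and the second-order expansion of [cyc_sum] *)

Definition fwd_sum {R : nmodType} {n : nat} (k : nat) (h : 'I_n -> R) (i : 'I_n) : R :=
  \sum_(1 <= j < k.+1) h (cshift i j).

(** Half the Hessian form of [cyc_sum] at the equal point. *)
Definition cyc_form {R : realType} {n : nat} (k : nat) (h : 'I_n -> R) : R :=
  \sum_(i < n) fwd_sum k h i * (fwd_sum k h i - k%:R * h i) / k%:R ^+ 3.

Lemma cshift_inj (n j : nat) : injective (fun i : 'I_n => cshift i j).
Proof.
move=> i i' /(congr1 val) /= /eqP; rewrite eqn_modDr !modn_small // => /eqP.
exact: val_inj.
Qed.

Lemma sum_cshift {R : nmodType} {n : nat} (F : 'I_n -> R) (j : nat) :
  \sum_(i < n) F (cshift i j) = \sum_(i < n) F i.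
Proof. by rewrite [RHS](reindex_inj (@cshift_inj n j)). Qed.

Lemma sum_fwd_sum {R : pzSemiRingType} {n : nat} (k : nat) (h : 'I_n -> R) :
  \sum_(i < n) fwd_sum k h i = k%:R * \sum_(i < n) h i.
Proof.
rewrite exchange_big /= (eq_bigr (fun=> \sum_(i < n) h i)); last first.
  by move=> j _; rewrite sum_cshift.
by rewrite big_const_nat iter_addr_0 subSS subn0 mulr_natl.
Qed.

Lemma fwd_sum_cst {R : pzSemiRingType} {n : nat} (k : nat) (a : R) (i : 'I_n) :
  fwd_sum k (fun=> a) i = k%:R * a.
Proof. by rewrite /fwd_sum big_const_nat iter_addr_0 subSS subn0 mulr_natl. Qed.

Lemma fwd_sumB {R : zmodType} {n : nat} (k : nat) (g h : 'I_n -> R) (i : 'I_n) :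
  fwd_sum k (fun j => g j - h j) i = fwd_sum k g i - fwd_sum k h i.
Proof. by rewrite /fwd_sum sumrB. Qed.

Lemma fwd_sumZ {R : pzSemiRingType} {n : nat} (k : nat) (a : R) (h : 'I_n -> R) (i : 'I_n) :
  fwd_sum k (fun j => a * h j) i = a * fwd_sum k h i.
Proof. by rewrite /fwd_sum mulr_sumr. Qed.

Lemma cyc_formZ {R : realType} {n : nat} (k : nat) (a : R) (h : 'I_n -> R) :
  cyc_form k (fun j => a * h j) = a ^+ 2 * cyc_form k h.
Proof.
rewrite /cyc_form mulr_sumr; apply: eq_bigr => i _; rewrite fwd_sumZ; ring.
Qed.

Lemma cyc_form_cst {R : realType} {n : nat} (k : nat) (a : R) :
  cyc_form k (fun _ : 'I_n => a) = 0.
Proof. by rewrite /cyc_form big1 // => i _; rewrite fwd_sum_cst subrr mulr0 mul0r. Qed.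

(* The linear terms cancel because [\sum_i (k h_i - fwd_sum k h i) = 0]; this
   makes the identity exact, for every base value [mu]. *)
Lemma cyc_sum_deviation {R : realType} {n k : nat} (x : 'rV[R]_n) (mu : R) :
    (0 < k)%N -> 0 < mu -> (forall i, 0 < x ord0 i) ->
  let s := fwd_sum k (fun i => x ord0 i - mu) in
  cyc_sum k x - n%:R / k%:R =
  \sum_(i < n) s i * (s i - k%:R * (x ord0 i - mu)) /
    (k%:R ^+ 2 * mu * fwd_sum k (x ord0) i).
Proof.
move=> k0 mu0 x0 s.
have K0 : (k%:R : R) != 0 by rewrite pnatr_eq0 -lt0n.
have sE i : s i = fwd_sum k (x ord0) i - k%:R * mu.
  by rewrite /s fwd_sumB fwd_sum_cst.
have S0 i : fwd_sum k (x ord0) i != 0.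
  rewrite gt_eqF // /fwd_sum big_nat_recl // ltr_wpDr //.
  by apply: sumr_ge0 => j _; exact: ltW.
have -> : n%:R / k%:R = \sum_(i < n) (k%:R : R)^-1.
  by rewrite sumr_const card_ord mulr_natl.
rewrite -sumrB.
have Z : \sum_(i < n) (k%:R * x ord0 i - fwd_sum k (x ord0) i) / (k%:R ^+ 2 * mu) = 0.
  by rewrite -mulr_suml sumrB sum_fwd_sum -mulr_sumr subrr mul0r.
transitivity (\sum_(i < n) ((x ord0 i / fwd_sum k (x ord0) i - k%:R^-1) -
    (k%:R * x ord0 i - fwd_sum k (x ord0) i) / (k%:R ^+ 2 * mu))).
  by rewrite [RHS]sumrB Z subr0.
apply: eq_bigr => i _; rewrite sE.
have := S0 i; move: (fwd_sum k (x ord0) i) => S S0'.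
have m0 : mu != 0 by rewrite gt_eqF.
by field; rewrite S0' m0 K0.
Qed.

Lemma sqr_le_sum {R : realType} {n : nat} (h : 'I_n -> R) (i : 'I_n) :
  h i ^+ 2 <= \sum_(j < n) h j ^+ 2.
Proof.
by rewrite (bigD1 i) //= lerDl; apply: sumr_ge0 => j _; exact: sqr_ge0.
Qed.

Lemma norm_fwd_sum_le {R : realType} {n k : nat} (h : 'I_n -> R) (M : R) (i : 'I_n) :
  (forall j, `|h j| <= M) -> `|fwd_sum k h i| <= k%:R * M.
Proof.
move=> hM; apply: (le_trans (ler_norm_sum _ _ _)).
rewrite -[leRHS](@fwd_sum_cst R n k M i); exact: ler_sum.
Qed.

(** Every entry is at most the Euclidean norm of [h], so the two factors are at most [k] and [2 * k]
    times that norm. *)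
Lemma norm_form_term_le {R : realType} {n k : nat} (h : 'I_n -> R) (i : 'I_n) :
  `|fwd_sum k h i * (fwd_sum k h i - k%:R * h i)|
    <= 2 * k%:R ^+ 2 * \sum_(j < n) h j ^+ 2.
Proof.
set H := \sum_(j < n) _.
have H0 : 0 <= H by apply: sumr_ge0 => j _; exact: sqr_ge0.
have hM j : `|h j| <= Num.sqrt H.
  by rewrite -sqrtr_sqr ler_wsqrtr // sqr_le_sum.
have sM := @norm_fwd_sum_le R n k h _ i hM.
have K0 : (0 : R) <= k%:R by [].
have dM : `|fwd_sum k h i - k%:R * h i| <= 2 * k%:R * Num.sqrt H.
  apply: (le_trans (ler_normB _ _)).
  have -> : 2 * k%:R * Num.sqrt H = k%:R * Num.sqrt H + k%:R * Num.sqrt H by ring.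
  by rewrite lerD // normrM ger0_norm // ler_wpM2l.
rewrite normrM.
have -> : 2 * k%:R ^+ 2 * H = (k%:R * Num.sqrt H) * (2 * k%:R * Num.sqrt H).
  rewrite -{1}(sqr_sqrtr H0); ring.
exact: ler_pM.
Qed.

(** The numerators of [cyc_sum_deviation] are exact, so the error comes only from replacing each
    denominator by [k ^ 3]. The base [mu] stays free: the lower bound takes the mean, the rays take
    1. *)
Lemma cyc_sum_expansion {R : realType} {n k : nat} (x : 'rV[R]_n) (mu d : R) :
    (0 < k)%N -> d <= 1/2 -> `|mu - 1| <= d -> (forall i, `|x ord0 i - 1| <= d) ->
  let h i := x ord0 i - mu in
  `|cyc_sum k x - n%:R / k%:R - cyc_form k h|
    <= 24 * n%:R * d * \sum_(i < n) h i ^+ 2.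
Proof.
move=> k0 d2 mud xd /=; set h := fun i => x ord0 i - mu.
have d0 : 0 <= d := le_trans (normr_ge0 _) mud.
have := mud; rewrite ler_distl => /andP[mu1 mu2].
have xb i : 1 - d <= x ord0 i <= 1 + d by rewrite -ler_distl.
have x0 i : 0 < x ord0 i by case/andP: (xb i); lra.
have mu0 : 0 < mu by lra.
rewrite (cyc_sum_deviation _ mu k0) // -/h -sumrB.
set H := \sum_(i < n) h i ^+ 2.
have K1 : (1 : R) <= k%:R by rewrite ler1n.
have K0 : (0 : R) < k%:R by rewrite ltr0n.
apply: (le_trans (ler_norm_sum _ _ _)).
have -> : 24 * n%:R * d * H = \sum_(i < n) (24 * d * H).
  by rewrite sumr_const card_ord -[in RHS]mulr_natl; ring.
apply: ler_sum => i _.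
rewrite -mulrBr normrM.
have H0 : 0 <= H by apply: sumr_ge0 => j _; exact: sqr_ge0.
(* The second factor bounds the change of the inverse denominator; the product is
   [24 * d * H / k]. *)
apply: (@le_trans _ _ ((2 * k%:R ^+ 2 * H) * (12 * d / k%:R ^+ 3))); last first.
  have -> : 2 * k%:R ^+ 2 * H * (12 * d / k%:R ^+ 3) = 24 * d * H * k%:R^-1.
    by field; rewrite gt_eqF.
  rewrite ler_piMr // ?invf_le1 //; repeat apply: mulr_ge0 => //.
apply: ler_pM => //; first exact: norm_form_term_le.
have S1 : k%:R * (1 - d) <= fwd_sum k (x ord0) i.
  rewrite -(@fwd_sum_cst R n k (1 - d) i); apply: ler_sum => j _.
  by case/andP: (xb (cshift i j)).
have S2 : fwd_sum k (x ord0) i <= k%:R * (1 + d).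
  rewrite -(@fwd_sum_cst R n k (1 + d) i); apply: ler_sum => j _.
  by case/andP: (xb (cshift i j)).
(* The mean over the window. Both [mu] and [r] lie within [d] of 1, hence [mu * r >= 1/4] and
   [|1 - mu * r| <= 3 * d], with quotient at most [12 * d]. *)
pose r := fwd_sum k (x ord0) i / k%:R.
have SE : fwd_sum k (x ord0) i = k%:R * r by rewrite /r; field; rewrite gt_eqF.
rewrite SE !ler_pM2l // in S1 S2 *.
have p1 : (1 - d) * (1 - d) <= mu * r by apply: ler_pM => //; lra.
have p2 : mu * r <= (1 + d) * (1 + d) by apply: ler_pM => //; lra.
have p3 : 1/4 <= mu * r by nra.
have mu_n : mu != 0 by rewrite gt_eqF.
have r_n : r != 0 by rewrite gt_eqF //; lra.
have -> : (k%:R ^+ 2 * mu * (k%:R * r))^-1 - (k%:R ^+ 3)^-1 =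
    (1 - mu * r) / (mu * r) / k%:R ^+ 3.
  by field; rewrite mu_n r_n gt_eqF.
rewrite normrM [X in _ * X]gtr0_norm ?invr_gt0 ?exprn_gt0 //.
rewrite ler_pM2r ?invr_gt0 ?exprn_gt0 // normrM normfV.
rewrite [X in _ / X]gtr0_norm; last by lra.
rewrite ler_pdivrMr; last by lra.
rewrite ler_norml; apply/andP; split; nra.
Qed.

(** * Complex exponentials and roots of unity *)

Lemma Re_sum {R : realType} {I : Type} (r : seq I) (F : I -> R[i]) :
  complex.Re (\sum_(i <- r) F i) = \sum_(i <- r) complex.Re (F i).
Proof. by apply: (big_morph (@complex.Re R)) => // -[a b] [c d]. Qed.

Lemma Im_sum {R : realType} {I : Type} (r : seq I) (F : I -> R[i]) :
  complex.Im (\sum_(i <- r) F i) = \sum_(i <- r) complex.Im (F i).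
Proof. by apply: (big_morph (@complex.Im R)) => // -[a b] [c d]. Qed.

Lemma normc_sq {R : realType} (z : R[i]) :
  ComplexField.Normc.normc z ^+ 2 = complex.Re z ^+ 2 + complex.Im z ^+ 2.
Proof. by case: z => a b /=; rewrite sqr_sqrtr // addr_ge0 // sqr_ge0. Qed.

Lemma mul_conjc {R : realType} (z : R[i]) :
  z * conjc z = real_complex R (ComplexField.Normc.normc z ^+ 2).
Proof.
rewrite normc_sq; case: z => a b; apply/eqP; rewrite eq_complex /=.
by apply/andP; split; apply/eqP; ring.
Qed.

Lemma expiD {R : realType} (s t : R) : expi (s + t) = expi s * expi t.
Proof.
apply/eqP; rewrite eq_complex /= cosD sinD.
by apply/andP; split; apply/eqP; ring.
Qed.

Lemma expi_conj {R : realType} (t : R) : expi t * conjc (expi t) = 1.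
Proof. by rewrite mul_conjc normc_sq /= cos2Dsin2. Qed.

Definition unit_root (R : realType) (n : nat) : R[i] := expi (2 * pi / n%:R).

Lemma expi_unit_root {R : realType} (n a : nat) :
  expi (2 * pi * a%:R / n%:R : R) = unit_root R n ^+ a.
Proof.
elim: a => [|a IH].
  by rewrite mulr0 mul0r expr0 /expi cos0 sin0.
rewrite exprS -IH -expiD; congr expi; rewrite -natr1; ring.
Qed.

Lemma unit_root_expn {R : realType} (n : nat) : (0 < n)%N -> unit_root R n ^+ n = 1.
Proof.
move=> n0; rewrite -expi_unit_root mulfK ?pnatr_eq0 -?lt0n //.
by rewrite /expi mulrC mulr_natr cos2pi sin2pi.
Qed.

(** For [t = pi * d / n], strictly between 0 and [pi], the real part is [1 - 2 * sin t ^ 2 < 1]. *)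
Lemma unit_root_neq1 {R : realType} (n d : nat) : (0 < d < n)%N -> unit_root R n ^+ d != 1.
Proof.
move=> /andP[d0 dn]; rewrite -expi_unit_root eq_complex /= negb_and.
have n0 : (0 : R) < n%:R by rewrite ltr0n (leq_trans _ dn).
have -> : 2 * pi * d%:R / n%:R = (pi * d%:R / n%:R : R) *+ 2 by rewrite -mulr_natl; ring.
set t := pi * d%:R / n%:R.
have t0 : 0 < t < pi.
  apply/andP; split; first by rewrite divr_gt0 // mulr_gt0 ?pi_gt0 ?ltr0n.
  by rewrite ltr_pdivrMr // ltr_pM2l ?pi_gt0 // ltr_nat.
have s0 := sin_gt0_pi t0.
apply/orP; left; rewrite lt_eqF // cos_mulr2n cos2sin2; nra.
Qed.

Lemma unit_root_prim {R : realType} (n : nat) :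
  (0 < n)%N -> n.-primitive_root (unit_root R n).
Proof.
move=> n0; have [m mP mn] := prim_order_exists n0 (@unit_root_expn R n n0).
suff E : m = n by rewrite -{1}E.
apply/eqP; rewrite eqn_leq dvdn_leq //= leqNgt.
apply/negP => lt_mn; have := @unit_root_neq1 R n m.
by rewrite (prim_order_gt0 mP) lt_mn (prim_expr_order mP) eqxx => /(_ isT).
Qed.

Lemma unit_root_conj {R : realType} (n a : nat) :
  unit_root R n ^+ a * conjc (unit_root R n) ^+ a = 1.
Proof. by rewrite -exprMn expi_conj expr1n. Qed.

Lemma lambdaE {R : realType} (n m k : nat) :
  lambda_ R n m k = \sum_(1 <= j < k.+1) unit_root R n ^+ (m * j).
Proof. by apply: eq_bigr => j _; rewrite expi_unit_root. Qed.

(** Exponents matter only modulo [n], so the wrap-around in [cshift] disappears and a shift acts on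
    waves as a scalar. *)
Lemma unit_root_cshift {R : realType} (n m j : nat) (i : 'I_n) :
  unit_root R n ^+ (m * cshift i j) = unit_root R n ^+ (m * j) * unit_root R n ^+ (m * i).
Proof.
have n0 : (0 < n)%N by exact: leq_trans (ltn_ord i).
have wP := @unit_root_prim R n n0.
rewrite -exprD -mulnDr -(prim_expr_mod wP) /= modnMmr (prim_expr_mod wP).
by rewrite addnC.
Qed.

(** * Discrete Fourier transform and diagonalisation of the form *)

(** Unnormalised, with positive exponents: hence the factor [n] in [plancherel] and the conjugate in
    [dft_fwd_sum]. *)
Definition dft {R : realType} {n : nat} (h : 'I_n -> R) (m : nat) : R[i] :=
  \sum_(i < n) real_complex R (h i) * unit_root R n ^+ (m * i).

(** Orthogonality of characters: the sum is geometric, and its ratio [z] is an [n]-th root of unity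
    equal to 1 only when [i = j]. *)
Lemma sum_unit_root {R : realType} (n : nat) (i j : 'I_n) :
  \sum_(m < n) unit_root R n ^+ (m * i) * conjc (unit_root R n) ^+ (m * j) =
  (if i == j then n%:R else 0).
Proof.
have n0 : (0 < n)%N by exact: leq_trans (ltn_ord i).
have wP := @unit_root_prim R n n0.
pose z := unit_root R n ^+ i * conjc (unit_root R n) ^+ j.
have zE m : unit_root R n ^+ (m * i) * conjc (unit_root R n) ^+ (m * j) = z ^+ m.
  by rewrite /z exprMn -!exprM ![(m * _)%N]mulnC.
under eq_bigr do rewrite zE.
case: eqVneq => [ij|nij].
  under eq_bigr do rewrite /z ij unit_root_conj expr1n.
  by rewrite sumr_const card_ord.
have z1 : z != 1.
  apply: contra nij => /eqP zz; apply/eqP/val_inj/eqP.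
  rewrite /= -(modn_small (ltn_ord i)) -(modn_small (ltn_ord j)).
  rewrite -(eq_prim_root_expr wP).
  by rewrite -[_ ^+ i]mulr1 -(@unit_root_conj R n j) mulrCA -/z zz mulr1.
have zn : z ^+ n = 1.
  have cn : conjc (unit_root R n) ^+ n = 1.
    by rewrite -[LHS]mul1r -{1}(prim_expr_order wP) unit_root_conj.
  by rewrite /z exprMn -!exprM ![(_ * n)%N]mulnC !exprM (prim_expr_order wP) cn !expr1n mulr1.
have := @subrX1 _ z n; rewrite zn subrr => /esym/eqP.
by rewrite mulf_eq0 subr_eq0 (negPf z1) => /eqP.
Qed.

Lemma conjc_dft_term {R : realType} (n a : nat) (b : R) :
  conjc (real_complex R b * unit_root R n ^+ a) =
  real_complex R b * conjc (unit_root R n) ^+ a.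
Proof. by rewrite rmorphM rmorphXn; congr (_ * _); exact: conjc_real. Qed.

(** Two functions are needed because the form pairs [fwd_sum k h] with [h] as well as with
    itself. *)
Lemma plancherel {R : realType} {n : nat} (g h : 'I_n -> R) :
  \sum_(m < n) dft g m * conjc (dft h m) = real_complex R (n%:R * \sum_(i < n) g i * h i).
Proof.
transitivity (\sum_(i < n) \sum_(j < n) real_complex R (g i * h j) *
  \sum_(m < n) unit_root R n ^+ (m * i) * conjc (unit_root R n) ^+ (m * j)).
  under eq_bigr => m _.
    rewrite /dft rmorph_sum mulr_suml.
    under eq_bigr => i _ do rewrite mulr_sumr.
    over.
  rewrite exchange_big /=; apply: eq_bigr => i _.
  rewrite exchange_big /=; apply: eq_bigr => j _.
  rewrite mulr_sumr; apply: eq_bigr => m _.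
  rewrite conjc_dft_term [real_complex R (g i * h j)]rmorphM; ring.
rewrite mulr_sumr rmorph_sum; apply: eq_bigr => i _.
under eq_bigr => j _ do rewrite sum_unit_root.
rewrite (bigD1 i) // big1 => [|j /andP[_ nji]]; last first.
  by rewrite eq_sym (negPf nji) mulr0.
by rewrite eqxx [LHS]addr0 mulrC [RHS]rmorphM rmorph_nat.
Qed.

(** Undoing the shift by [j] multiplies the transform by the conjugate of the wave at [j]; these
    factors add up to the conjugate of [lambda_]. *)
Lemma dft_fwd_sum {R : realType} {n k : nat} (h : 'I_n -> R) (m : nat) :
  dft (fwd_sum k h) m = conjc (lambda_ R n m k) * dft h m.
Proof.
rewrite lambdaE rmorph_sum mulr_suml /dft.
under eq_bigr => i _ do rewrite rmorph_sum mulr_suml.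
rewrite exchange_big /=; apply: eq_bigr => j _.
rewrite mulr_sumr -[RHS](@sum_cshift _ n _ j); apply: eq_bigr => i _.
have -> : conjc (unit_root R n ^+ (m * j)) = conjc (unit_root R n) ^+ (m * j).
  by rewrite rmorphXn.
rewrite unit_root_cshift -[LHS]mulr1 -[X in _ * X = _](@unit_root_conj R n (m * j)).
ring.
Qed.

Lemma loc_ratioE {R : realType} (n k m : nat) (hk : (0 < k)%N) :
  k%:R ^+ 3 * loc_ratio R n k m =
  ComplexField.Normc.normc (lambda_ R n m k) ^+ 2 - k%:R * complex.Re (lambda_ R n m k).
Proof. by rewrite mulrC divfK // expf_neq0 // pnatr_eq0 -lt0n. Qed.

Lemma cyc_formE {R : realType} {n : nat} (k : nat) (h : 'I_n -> R) (hk : (0 < k)%N) :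
  k%:R ^+ 3 * cyc_form k h =
  \sum_(i < n) fwd_sum k h i * fwd_sum k h i - k%:R * \sum_(i < n) fwd_sum k h i * h i.
Proof.
have k0 : (k%:R : R) != 0 by rewrite pnatr_eq0 -lt0n.
rewrite /cyc_form !mulr_sumr -sumrB; apply: eq_bigr => i _; by field.
Qed.

(** Plancherel turns the two pairings of [cyc_formE] into sums of squared moduli of [dft h m],
    weighted by the squared modulus and by the conjugate of [lambda_]; real parts give the numerator
    of [loc_ratio]. *)
Lemma cyc_form_dft {R : realType} {n k : nat} (h : 'I_n -> R) (hk : (0 < k)%N) :
  n%:R * cyc_form k h =
  \sum_(m < n) loc_ratio R n k m * ComplexField.Normc.normc (dft h m) ^+ 2.
Proof.
have k0 : (k%:R ^+ 3 : R) != 0 by rewrite expf_neq0 // pnatr_eq0 -lt0n.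
apply: (mulfI k0); rewrite mulrCA cyc_formE // mulrBr mulrCA.
(* Writing the real sums as real parts allows [plancherel] to be used from right to left. *)
rewrite -[n%:R * \sum_(i < n) fwd_sum k h i * fwd_sum k h i]/(complex.Re (real_complex R _)).
rewrite -[n%:R * \sum_(i < n) fwd_sum k h i * h i]/(complex.Re (real_complex R _)).
rewrite -!plancherel !Re_sum !mulr_sumr -sumrB; apply: eq_bigr => m _.
rewrite mulrA loc_ratioE // !dft_fwd_sum.
set l := lambda_ R n m k; set z := dft h m.
rewrite !normc_sq; case: l z => [a b] [c d] /=; ring.
Qed.

Lemma Cloc_le {R : realType} (n k m : nat) : (0 < m < n)%N -> Cloc R n k <= loc_ratio R n k m.
Proof. by move=> mn; apply: ge_bigmin_seq => //; rewrite mem_index_iota. Qed.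

Lemma Cloc_attained {R : realType} (n k : nat) : (2 <= n)%N ->
  exists2 m, (0 < m < n)%N & Cloc R n k = loc_ratio R n k m.
Proof.
(* [big_seq] keeps the range condition; the initial value, [m = 1], is in range as [2 <= n]. *)
move=> n2; rewrite /Cloc big_seq.
apply: (big_ind (fun c => exists2 m, (0 < m < n)%N & c = loc_ratio R n k m)).
- by exists 1%N.
- by move=> c d Hc Hd; rewrite minEle; case: ifP.
- by move=> m; rewrite mem_index_iota => mn; exists m.
Qed.

(** Frequency 0 has ratio 0, which may lie below [Cloc]; the zero-sum hypothesis removes it,
    [dft h 0] being the sum of [h]. *)
Lemma cyc_form_ge {R : realType} {n k : nat} (h : 'I_n -> R) :
    (0 < n)%N -> (0 < k)%N -> \sum_(i < n) h i = 0 ->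
  Cloc R n k * \sum_(i < n) h i ^+ 2 <= cyc_form k h.
Proof.
move=> n0 k0 h0.
have N0 : (0 : R) < n%:R by rewrite ltr0n.
rewrite -(ler_pM2l N0) cyc_form_dft // mulrCA.
have -> : n%:R * \sum_(i < n) h i ^+ 2 =
    \sum_(m < n) ComplexField.Normc.normc (dft h m) ^+ 2.
  have /(congr1 (@complex.Re R)) /= <- := plancherel h h.
  by rewrite Re_sum; apply: eq_bigr => m _; rewrite mul_conjc.
rewrite mulr_sumr; apply: ler_sum => -[[|m] mn] _ /=.
  suff -> : dft h 0 = 0 by rewrite ComplexField.Normc.normc0 expr0n /= !mulr0.
  rewrite /dft; under eq_bigr do rewrite mul0n expr0 mulr1.
  by rewrite -rmorph_sum h0 rmorph0.
by rewrite ler_wpM2r ?sqr_ge0 // Cloc_le.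
Qed.

(** Forward sums multiply a wave by [lambda_], and waves have modulus 1. Adding the real and
    imaginary contributions therefore gives [loc_ratio R n k m] at each position separately. *)
Lemma cyc_form_wave {R : realType} (n k m : nat) : (0 < k)%N ->
  cyc_form k (fun i : 'I_n => complex.Re (unit_root R n ^+ (m * i))) +
  cyc_form k (fun i : 'I_n => complex.Im (unit_root R n ^+ (m * i))) =
  n%:R * loc_ratio R n k m.
Proof.
move=> k0; have K0 : (k%:R ^+ 3 : R) != 0 by rewrite expf_neq0 // pnatr_eq0 -lt0n.
rewrite /cyc_form -big_split /=.
have -> : n%:R * loc_ratio R n k m = \sum_(i < n) loc_ratio R n k m.
  by rewrite sumr_const card_ord mulr_natl.
apply: eq_bigr => i _; apply: (mulfI K0); rewrite loc_ratioE //.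
have L : lambda_ R n m k * unit_root R n ^+ (m * i) =
    \sum_(1 <= j < k.+1) unit_root R n ^+ (m * cshift i j).
  by rewrite lambdaE mulr_suml; apply: eq_bigr => j _; rewrite unit_root_cshift.
have -> : fwd_sum k (fun i : 'I_n => complex.Re (unit_root R n ^+ (m * i))) i =
    complex.Re (lambda_ R n m k * unit_root R n ^+ (m * i)) by rewrite L Re_sum.
have -> : fwd_sum k (fun i : 'I_n => complex.Im (unit_root R n ^+ (m * i))) i =
    complex.Im (lambda_ R n m k * unit_root R n ^+ (m * i)) by rewrite L Im_sum.
have : complex.Re (unit_root R n ^+ (m * i)) ^+ 2 +
    complex.Im (unit_root R n ^+ (m * i)) ^+ 2 = 1.
  by rewrite -expi_unit_root /= cos2Dsin2.
move: (lambda_ R n m k) (unit_root R n ^+ (m * i)) => l z.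
rewrite normc_sq; case: l z => [a b] [c d] /= cd.
(* Multiplying by [c ^+ 2 + d ^+ 2 = 1] turns the goal into a polynomial identity up to division by
   [k]. *)
have -> : a ^+ 2 + b ^+ 2 - k%:R * a =
  (a ^+ 2 + b ^+ 2 - k%:R * a) * (c ^+ 2 + d ^+ 2) by rewrite cd mulr1.
have k1 : (k%:R : R) != 0 by rewrite pnatr_eq0 -lt0n.
by field.
Qed.

(** * Squared deviations from the mean, and their behaviour under logarithms *)

(** [log_dev x] is convertible to [sqdev] of the logarithms; later steps rely on this. *)
Definition sqdev {R : realType} {n : nat} (u : 'I_n -> R) : R :=
  \sum_(i < n) (u i - n%:R^-1 * \sum_(j < n) u j) ^+ 2.

Lemma sqdev_ge0 {R : realType} {n : nat} (u : 'I_n -> R) : 0 <= sqdev u.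
Proof. by apply: sumr_ge0 => i _; exact: sqr_ge0. Qed.

(** The mean is the best centre: any other loses [n * (m - c) ^ 2]. *)
Lemma sqdev_le {R : realType} {n : nat} (u : 'I_n -> R) (c : R) :
  (0 < n)%N -> sqdev u <= \sum_(i < n) (u i - c) ^+ 2.
Proof.
move=> n0; have N0 : (n%:R : R) != 0 by rewrite pnatr_eq0 -lt0n.
rewrite /sqdev; set m := n%:R^-1 * _.
rewrite -subr_ge0 -sumrB.
have -> : \sum_(i < n) ((u i - c) ^+ 2 - (u i - m) ^+ 2) =
    \sum_(i < n) (2 * (m - c) * u i + (c ^+ 2 - m ^+ 2)).
  by apply: eq_bigr => i _; ring.
rewrite big_split /= -mulr_sumr sumr_const card_ord -[X in _ + X]mulr_natl.
have -> : \sum_(i < n) u i = n%:R * m by rewrite /m mulrA divff // mul1r.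
have -> : 2 * (m - c) * (n%:R * m) + n%:R * (c ^+ 2 - m ^+ 2) = n%:R * (m - c) ^+ 2 by ring.
by rewrite mulr_ge0 // sqr_ge0.
Qed.

Lemma sqdev_affine {R : realType} {n : nat} (a t : R) (u : 'I_n -> R) :
  (0 < n)%N -> sqdev (fun i => a + t * u i) = t ^+ 2 * sqdev u.
Proof.
move=> n0; have N0 : (n%:R : R) != 0 by rewrite pnatr_eq0 -lt0n.
rewrite /sqdev [RHS]mulr_sumr; apply: eq_bigr => i _.
rewrite big_split /= -mulr_sumr sumr_const card_ord -[a *+ n]mulr_natl.
by field.
Qed.

Lemma sqdev_eq0 {R : realType} {n : nat} (u : 'I_n -> R) :
  sqdev u <= 0 -> exists c, forall i, u i = c.
Proof.
move=> u0; exists (n%:R^-1 * \sum_(j < n) u j) => i.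
have /eqP : sqdev u = 0 by apply/eqP; rewrite eq_le u0 sqdev_ge0.
rewrite psumr_eq0 => [|j _]; last exact: sqr_ge0.
by move=> /allP /(_ i (mem_index_enum _)) /=; rewrite sqrf_eq0 subr_eq0 => /eqP.
Qed.

(** The tangent bound for [ln]. The next two lemmas apply it with the smaller and with the larger
    argument as base point. *)
Lemma lnB_le {R : realType} (x y : R) : 0 < x -> 0 < y -> ln x - ln y <= (x - y) / y.
Proof.
move=> x0 y0; rewrite -ln_div // ?posrE //.
have -> : x / y = 1 + (x - y) / y by field; rewrite gt_eqF.
apply: le_ln1Dx.
by rewrite mulrBl divff ?gt_eqF // ltrBrDr addrC subrr divr_gt0.
Qed.

Lemma ln_lipschitz {R : realType} (a x y : R) :
  0 < a -> a <= x -> a <= y -> a * `|ln x - ln y| <= `|x - y|.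
Proof.
move=> a0; wlog xy : x y / y <= x.
  move=> H ax ay; have [yx|xy] := leP y x; first exact: H.
  by rewrite distrC [leRHS]distrC; apply: H => //; exact: ltW.
move=> ax ay.
have x0 : 0 < x by exact: lt_le_trans ax.
have y0 : 0 < y by exact: lt_le_trans ay.
rewrite !ger0_norm ?subr_ge0 ?ler_ln ?posrE //.
apply: (@le_trans _ _ (y * (ln x - ln y))).
  by rewrite ler_wpM2r // subr_ge0 ler_ln ?posrE.
by rewrite mulrC -ler_pdivlMr // lnB_le.
Qed.

Lemma ln_expanding {R : realType} (b x y : R) :
  0 < x <= b -> 0 < y <= b -> `|x - y| <= b * `|ln x - ln y|.
Proof.
wlog xy : x y / y <= x.
  move=> H xb yb; have [yx|xy] := leP y x; first exact: H.
  by rewrite distrC [X in _ <= _ * X]distrC; apply: H => //; exact: ltW.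
move=> /andP[x0 xb] /andP[y0 yb].
rewrite !ger0_norm ?subr_ge0 ?ler_ln ?posrE //.
apply: (@le_trans _ _ (x * (ln x - ln y))); last first.
  by rewrite ler_wpM2r // subr_ge0 ler_ln ?posrE.
have := lnB_le _ _ y0 x0; rewrite ler_pdivlMr // -[y - x]opprB -[ln y - _]opprB.
by rewrite mulNr lerN2 mulrC.
Qed.

(** The logarithms are centred at [ln mu], which need not be their mean; [sqdev_le] absorbs the
    difference. *)
Lemma log_dev_le {R : realType} {n : nat} (x : 'rV[R]_n) (a mu : R) :
    (0 < n)%N -> 0 < a -> a <= mu -> (forall i, a <= x ord0 i) ->
  a ^+ 2 * log_dev x <= \sum_(i < n) (x ord0 i - mu) ^+ 2.
Proof.
move=> n0 a0 amu ax.
apply: (@le_trans _ _ (a ^+ 2 * \sum_(i < n) (ln (x ord0 i) - ln mu) ^+ 2)).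
  by rewrite ler_wpM2l ?sqr_ge0 //; exact: (@sqdev_le R n (fun i => ln (x ord0 i))).
rewrite mulr_sumr; apply: ler_sum => i _.
rewrite -exprMn -[leRHS]real_normK ?num_real // -[leLHS]real_normK ?num_real // ler_sqr ?nnegrE //.
by rewrite normrM (gtr0_norm a0) ln_lipschitz.
Qed.

(** Here [x] is centred at its geometric mean [expR (mean_log x)], which is at most [b] because
    every coordinate is. *)
Lemma log_dev_ge {R : realType} {n : nat} (x : 'rV[R]_n) (b : R) :
    (0 < n)%N -> (forall i, 0 < x ord0 i <= b) ->
  sqdev (x ord0) <= b ^+ 2 * log_dev x.
Proof.
move=> n0 xb.
have N0 : (0 : R) < n%:R by rewrite ltr0n.
have b0 : 0 < b by case/andP: (xb (Ordinal n0)) => p; exact: lt_le_trans.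
have eb : 0 < expR (mean_log x) <= b.
  rewrite expR_gt0 /= -(@lnK _ b) ?posrE // ler_expR /mean_log ler_pdivrMl //.
  have -> : n%:R * ln b = \sum_(i < n) ln b by rewrite sumr_const card_ord mulr_natl.
  by apply: ler_sum => i _; case/andP: (xb i) => p q; rewrite ler_ln ?posrE.
apply: (le_trans (sqdev_le (x ord0) (expR (mean_log x)) n0)).
rewrite /log_dev mulr_sumr; apply: ler_sum => i _.
rewrite -exprMn -[leRHS]real_normK ?num_real // -[leLHS]real_normK ?num_real // ler_sqr ?nnegrE //.
rewrite normrM (gtr0_norm b0); have := @ln_expanding R b _ _ (xb i) eb.
by rewrite expRK.
Qed.

(** * Neighbourhoods of the equal point and [cyc_sum] along rays *)

Lemma nbhs_equal_pt {R : realType} {n : nat} (d : R) :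
  0 < d -> nbhs (equal_pt R n) [set x | forall i, `|x ord0 i - 1| <= d]%classic.
Proof.
move=> d0; apply/nbhs_ballP; exists d => //= x [_ xd] i.
by have := xd ord0 i; rewrite /ball /= mxE distrC => /ltW.
Qed.

Lemma nbhs_equal_ptP {R : realType} {n : nat} (U : set 'rV[R]_n) :
  nbhs (equal_pt R n) U ->
  exists2 d : R, 0 < d & forall x : 'rV[R]_n, (forall i, `|x ord0 i - 1| < d) -> U x.
Proof.
move=> /nbhs_ballP[d /= d0 dU]; exists d => // x xd; apply: dU; split=> // i j.
by rewrite ord1 /ball /= mxE distrC; exact: xd.
Qed.

Definition ray_pt {R : realType} {n : nat} (v : 'I_n -> R) (t : R) : 'rV[R]_n :=
  \row_i (1 + t * v i).

(** Base value 1 makes the deviation exactly [t * v]; with [d = t] the error is cubic in [t]. *)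
Lemma cyc_sum_ray {R : realType} {n k : nat} (v : 'I_n -> R) (t : R) :
    (0 < k)%N -> (forall i, `|v i| <= 1) -> 0 <= t <= 1/2 ->
  `|cyc_sum k (ray_pt v t) - n%:R / k%:R - t ^+ 2 * cyc_form k v|
    <= 24 * n%:R ^+ 2 * t ^+ 3.
Proof.
move=> k0 v1 /andP[t0 t2].
have xd i : `|ray_pt v t ord0 i - 1| <= t.
  by rewrite mxE addrC addKr normrM ger0_norm // ler_piMr.
have mud : `|1 - 1 : R| <= t by rewrite subrr normr0.
have := cyc_sum_expansion (ray_pt v t) 1 t k0 t2 mud xd; cbv zeta.
have hE i : ray_pt v t ord0 i - 1 = t * v i by rewrite mxE addrC addKr.
under eq_bigr do rewrite hE exprMn.
have -> : (fun i => ray_pt v t ord0 i - 1) = (fun i => t * v i) by apply/funext => i.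
rewrite cyc_formZ => /le_trans; apply; rewrite -mulr_sumr.
have -> : 24 * n%:R ^+ 2 * t ^+ 3 = 24 * n%:R * t * (t ^+ 2 * n%:R) by ring.
rewrite ler_wpM2l //; first by rewrite !mulr_ge0.
rewrite ler_wpM2l ?sqr_ge0 //.
have -> : (n%:R : R) = \sum_(i < n) 1 by rewrite sumr_const card_ord.
by apply: ler_sum => i _; rewrite -real_normK ?num_real // expr_le1.
Qed.

(** Along a short ray the form dominates the deviation. The product in the conclusion treats both
    signs at once. *)
Lemma cyc_sum_sign_near {R : realType} {n k : nat} (v : 'I_n -> R) :
    (0 < n)%N -> (0 < k)%N -> (forall i, `|v i| <= 1) -> cyc_form k v != 0 ->
  forall U, nbhs (equal_pt R n) U ->
  exists x, [/\ U x, pos_orthant x & 0 < (cyc_sum k x - n%:R / k%:R) * cyc_form k v].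
Proof.
move=> n0 k0 v1 q0 U /nbhs_equal_ptP[d d0 dU].
have N0 : (0 : R) < n%:R by rewrite ltr0n.
set q := cyc_form k v in q0 *.
have Q0 : 0 < `|q| by rewrite normr_gt0.
(* The bounds serve the expansion, the neighbourhood, and a cubic error of at most half of
   [t ^ 2 * |q|]. *)
pose t := Num.min (1/2) (Num.min (d / 2) (`|q| / (48 * n%:R ^+ 2))).
have t0 : 0 < t.
  by rewrite !lt_min !divr_gt0 // ?mulr_gt0 ?exprn_gt0.
have t1 : t <= 1/2 by rewrite ge_min lexx.
have t2 : t <= d / 2 by rewrite ge_min [in X in _ || X]ge_min lexx orbT.
have t3 : t * (48 * n%:R ^+ 2) <= `|q|.
  rewrite -ler_pdivlMr; last by rewrite mulr_gt0 // exprn_gt0.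
  by rewrite ge_min [in X in _ || X]ge_min lexx !orbT.
have tv i : `|t * v i| <= t by rewrite normrM gtr0_norm // ler_piMr // ltW.
exists (ray_pt v t); split.
- apply: dU => i; rewrite mxE addrC addKr; apply: (le_lt_trans (tv i)); lra.
- by move=> i; rewrite mxE; have := tv i; rewrite ler_norml => /andP[]; lra.
have B := @cyc_sum_ray R n k v t k0 v1; rewrite (ltW t0) t1 in B.
move: (B isT); rewrite -/q; set D := _ - n%:R / _ => {}B.
have B1 : `|(D - t ^+ 2 * q) * q| <= t ^+ 2 * `|q| / 2 * `|q|.
  rewrite normrM ler_wpM2r //; apply: (le_trans B).
  have -> : 24 * n%:R ^+ 2 * t ^+ 3 = t ^+ 2 / 2 * (t * (48 * n%:R ^+ 2)) by field.
  have -> : t ^+ 2 * `|q| / 2 = t ^+ 2 / 2 * `|q| by ring.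
  by rewrite ler_wpM2l // divr_ge0 // sqr_ge0.
have -> : D * q = t ^+ 2 * q ^+ 2 + (D - t ^+ 2 * q) * q by ring.
move: B1; rewrite ler_norml => /andP[+ _].
have -> : t ^+ 2 * `|q| / 2 * `|q| = t ^+ 2 * q ^+ 2 / 2.
  by rewrite -[q ^+ 2]real_normK ?num_real //; ring.
have : 0 < t ^+ 2 * q ^+ 2 by rewrite mulr_gt0 // ?(exprn_gt0 _ t0) // exprn_even_gt0.
lra.
Qed.

(** As [k < n], the window after [i0] never returns to [i0], so the mixed terms vanish and squares
    remain; not all are zero, as the forward sums add up to [k]. This is the rising direction of the
    saddle. *)
Lemma cyc_form_delta_gt0 {R : realType} {n k : nat} (i0 : 'I_n) : (0 < k < n)%N ->
  0 < cyc_form k (fun i => if i == i0 then 1 else 0 : R).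
Proof.
move=> /andP[k0 kn]; set v := fun i : 'I_n => _.
have n0 : (0 < n)%N by exact: leq_trans kn.
have K3 : (0 : R) < k%:R ^+ 3 by rewrite exprn_gt0 // ltr0n.
have s0 : fwd_sum k v i0 = 0.
  rewrite /fwd_sum big_nat big1 // => j /andP[j0 jk]; rewrite /v.
  case: eqP => // /(congr1 val)/= /eqP.
  rewrite -[X in _ == X](modn_small (ltn_ord i0)) -[X in _ == X %[mod n]]addn0 eqn_modDl.
  by rewrite mod0n modn_small ?(leq_trans jk) // gtn_eqF.
have E : cyc_form k v = \sum_(i < n) fwd_sum k v i ^+ 2 / k%:R ^+ 3.
  apply: eq_bigr => i _; rewrite {3}/v.
  by case: eqP => [->|_]; rewrite ?s0 ?mul0r ?expr0n ?mul0r // mulr0 subr0 expr2.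
have t0 i : 0 <= fwd_sum k v i ^+ 2 / k%:R ^+ 3.
  by rewrite divr_ge0 ?sqr_ge0 // ltW.
rewrite lt_def E sumr_ge0 // andbT psumr_eq0 //; apply/negP => /allP z.
have : \sum_(i < n) fwd_sum k v i = 0.
  rewrite big1 // => i _; have := z i (mem_index_enum _).
  by rewrite /= mulf_eq0 invr_eq0 (gt_eqF K3) orbF sqrf_eq0 => /eqP.
rewrite sum_fwd_sum (bigD1 i0) //= big1 => [|i /negPf ni]; last by rewrite /v ni.
by rewrite /v eqxx addr0 mulr1 => /eqP; rewrite pnatr_eq0 -leqn0 leqNgt k0.
Qed.

(** * Criticality of the equal point *)

Lemma cyc_sum_equal_pt {R : realType} (n k : nat) : (0 < k)%N ->
  cyc_sum k (equal_pt R n) = n%:R / k%:R.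
Proof.
move=> k0; rewrite /cyc_sum (eq_bigr (fun=> k%:R^-1)) => [|i _].
  by rewrite sumr_const card_ord mulr_natl.
rewrite mxE mul1r; congr (_^-1).
rewrite -[RHS]mulr1 -(@fwd_sum_cst R n k 1 i); apply: eq_bigr => j _.
by rewrite mxE.
Qed.

(** A crude second-order bound, enough for a zero differential: 14 is [24 * (1/2)] from the
    expansion error plus 2 from the form. *)
Lemma cyc_sum_quadratic {R : realType} {n k : nat} (h : 'rV[R]_n) :
    (0 < k)%N -> `|h| <= 1/2 ->
  `|cyc_sum k (h + equal_pt R n) - n%:R / k%:R| <= 14 * n%:R ^+ 2 * `|h| ^+ 2.
Proof.
move=> k0 h2; have K1 : (1 : R) <= k%:R by rewrite ler1n.
have hi i : `|h ord0 i| <= `|h|.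
  rewrite [leRHS]mx_normrE.
  exact: (@le_bigmax _ _ _ _ (fun i : 'I_1 * 'I_n => `|h i.1 i.2|) (ord0, i)).
have hE i : (h + equal_pt R n) ord0 i - 1 = h ord0 i by rewrite !mxE addrK.
have mud : `|1 - 1 : R| <= `|h| by rewrite subrr normr0.
have xd i : `|(h + equal_pt R n) ord0 i - 1| <= `|h| by rewrite hE.
have := cyc_sum_expansion (h + equal_pt R n) 1 `|h| k0 h2 mud xd; cbv zeta.
under eq_bigr do rewrite hE.
have -> : (fun i => (h + equal_pt R n) ord0 i - 1) = h ord0 by apply/funext => i.
set D := _ - _ / _; set H := \sum_(i < n) _; set q := cyc_form _ _ => B.
have H0 : 0 <= H by apply: sumr_ge0 => i _; exact: sqr_ge0.
have HN : H <= n%:R * `|h| ^+ 2.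
  have -> : n%:R * `|h| ^+ 2 = \sum_(i < n) `|h| ^+ 2 by rewrite sumr_const card_ord mulr_natl.
  by apply: ler_sum => i _; rewrite -[leLHS]real_normK ?num_real // ler_sqr ?nnegrE.
have qB : `|q| <= 2 * n%:R * H.
  apply: (le_trans (ler_norm_sum _ _ _)).
  have -> : 2 * n%:R * H = \sum_(i < n) (2 * H).
    by rewrite sumr_const card_ord -[RHS]mulr_natl; ring.
  apply: ler_sum => i _; rewrite normrM normfV [X in _ / X]ger0_norm ?exprn_ge0 //.
  rewrite ler_pdivrMr ?exprn_gt0 ?ltr0n //; apply: (le_trans (norm_form_term_le _ _)).
  rewrite -/H; have -> : 2 * k%:R ^+ 2 * H = 2 * H * k%:R ^+ 2 by ring.
  by apply: ler_wpM2l; [rewrite mulr_ge0 | apply: ler_weXn2l].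
have -> : D = (D - q) + q by rewrite subrK.
apply: (le_trans (ler_normD _ _)); apply: (@le_trans _ _ (14 * n%:R * H)).
  have -> : 14 * n%:R * H = 24 * n%:R * (1/2) * H + 2 * n%:R * H by field.
  apply: lerD => //; apply: (le_trans B).
  by rewrite ler_wpM2r // ler_wpM2l // mulr_ge0.
have -> : 14 * n%:R ^+ 2 * `|h| ^+ 2 = 14 * n%:R * (n%:R * `|h| ^+ 2) by ring.
by rewrite ler_wpM2l // mulr_ge0.
Qed.

(** The zero map satisfies the little-o expansion, so by uniqueness it is the differential. *)
Lemma critical_equal_pt {R : realType} (n k : nat) : (0 < n)%N -> (0 < k)%N ->
  critical_pt (@cyc_sum R n k) (equal_pt R n).
Proof.
move=> n0 k0; have N0 : (0 : R) < n%:R by rewrite ltr0n.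
pose z : {linear 'rV[R]_n -> R^o} := \0.
have zc : continuous z by exact: cst_continuous.
have ze : @cyc_sum R n k \o shift (equal_pt R n) =
    cst (cyc_sum k (equal_pt R n)) + z +o_ (0 : 'rV[R]_n) id.
  apply/eqaddoP => e e0.
  have M0 : 0 < 14 * n%:R ^+ 2 :> R by rewrite mulr_gt0 // exprn_gt0.
  have m0 : 0 < Num.min (1/2) (e / (14 * n%:R ^+ 2)) by rewrite lt_min !divr_gt0.
  apply/nbhs_ballP; exists (Num.min (1/2) (e / (14 * n%:R ^+ 2))) => // h.
  rewrite -ball_normE /ball_ /= sub0r normrN lt_min => /andP[/ltW h1 /ltW]; rewrite ler_pdivlMr // => h2.
  rewrite /= !fctE /= cyc_sum_equal_pt // addr0.
  apply: (le_trans (cyc_sum_quadratic h k0 h1)).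
  by rewrite [`|h| ^+ 2]expr2 mulrA ler_wpM2r // mulrC.
have zd := diff_unique zc ze.
split; last by move=> v; rewrite zd.
by apply/diff_locallyP; rewrite zd.
Qed.

(** * Quadratic bounds and the three cases *)

Lemma quadratic_bound_near_weaken {R : realType} {n k : nat} (c c' : R) :
  c' <= c -> quadratic_bound_near n k c -> quadratic_bound_near n k c'.
Proof.
move=> cc; apply: filterS => x; apply: le_trans.
by rewrite ler_wpM2r // sqdev_ge0.
Qed.

(** With the mean as [mu], the form is at least [C * H], the expansion loses [24 * n * d * H], and
    passing to logarithms costs a factor [(1 - d) ^ 2]. *)
Lemma quadratic_bound_near_Cloc {R : realType} {n k : nat} (eps : R) :
    (0 < n)%N -> (0 < k)%N -> 0 < eps -> eps < Cloc R n k ->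
  quadratic_bound_near n k (Cloc R n k - eps).
Proof.
set C := Cloc R n k => n0 k0 e0 eC.
have N0 : (0 : R) < n%:R by rewrite ltr0n.
have C0 : 0 < C by exact: lt_trans eC.
have W0 : 0 < 24 * n%:R + 2 * C by rewrite addr_gt0 // mulr_gt0.
(* The losses [24 * n * d] and [2 * C * d] together are at most [eps]. *)
pose d := Num.min (1/2) (eps / (24 * n%:R + 2 * C)).
have d0 : 0 < d by rewrite lt_min !divr_gt0.
have d2 : d <= 1/2 by rewrite ge_min lexx.
have de : d * (24 * n%:R + 2 * C) <= eps by rewrite -ler_pdivlMr // ge_min lexx orbT.
apply: filterS (@nbhs_equal_pt R n d d0) => x xd _.
pose mu := n%:R^-1 * \sum_(i < n) x ord0 i.
have xb i : 1 - d <= x ord0 i <= 1 + d by rewrite -ler_distl.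
have sum_cst (a : R) : \sum_(i < n) a = n%:R * a by rewrite sumr_const card_ord mulr_natl.
have mub : 1 - d <= mu <= 1 + d.
  rewrite /mu ler_pdivlMl // ler_pdivrMl // -!sum_cst; apply/andP.
  by split; apply: ler_sum => i _; case/andP: (xb i).
have mud : `|mu - 1| <= d by rewrite ler_distl.
pose h (i : 'I_n) := x ord0 i - mu.
have h0 : \sum_(i < n) h i = 0.
  by rewrite sumrB sum_cst /mu mulrA divff ?gt_eqF // mul1r subrr.
have := cyc_sum_expansion x mu d k0 d2 mud xd; cbv zeta; rewrite -/h.
have := cyc_form_ge h n0 k0 h0; rewrite -/C.
have L : (1 - d) ^+ 2 * log_dev x <= \sum_(i < n) h i ^+ 2.
  apply: log_dev_le => //; first lra; first by case/andP: mub.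
  by move=> i; case/andP: (xb i).
have l0 : 0 <= log_dev x by exact: sqdev_ge0.
move: L; set H := \sum_(i < n) _; set D := _ - _ / _ => L F.
rewrite ler_norml => /andP[B _].
(* This sign, due to [eps < C], lets the lower bound on [H] be multiplied by the coefficient. *)
have c0 : 0 <= C - 24 * n%:R * d.
  have : 0 <= d * C by rewrite mulr_ge0 // ltW.
  lra.
have S1 : (C - 24 * n%:R * d) * ((1 - d) ^+ 2 * log_dev x) <= (C - 24 * n%:R * d) * H.
  exact: ler_wpM2l.
have S2 : C - eps <= (C - 24 * n%:R * d) * (1 - d) ^+ 2.
  have dN : 0 <= n%:R * d * d by rewrite !mulr_ge0 // ltW.
  have : (C - 24 * n%:R * d) * (1 - 2 * d) <= (C - 24 * n%:R * d) * (1 - d) ^+ 2.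
    apply: ler_wpM2l => //; have := sqr_ge0 d; lra.
  lra.
have := ler_wpM2r l0 S2.
lra.
Qed.

(** On the positive orthant [log_dev] vanishes only at constant vectors. *)
Lemma strict_local_min_of_quadratic_bound {R : realType} {n k : nat} (c : R) :
  0 < c -> quadratic_bound_near n k c -> strict_local_min_mod_scaling R n k.
Proof.
move=> c0; rewrite /quadratic_bound_near /strict_local_min_mod_scaling !near_withinE.
apply: filterS => x /[swap] xp /(_ xp) H nc; rewrite -subr_gt0.
apply: (lt_le_trans _ H); rewrite mulr_gt0 // lt_def sqdev_ge0 andbT.
apply/eqP => z; apply: nc.
have [|a ha] := @sqdev_eq0 R n (fun i => ln (x ord0 i)); first by rewrite -[leLHS]/(log_dev x) z.
exists (expR a); apply/rowP => i; rewrite mxE -(ha i) lnK //; exact: xp.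
Qed.

(** On the ray of a nonconstant [v], [log_dev] has order [t ^ 2], while a nonpositive form leaves
    [cyc_sum] an excess of order at most [t ^ 3]. *)
Lemma quadratic_bound_near_form {R : realType} {n k : nat} (c : R) (v : 'I_n -> R) :
    (0 < n)%N -> (0 < k)%N -> (forall i, `|v i| <= 1) -> 0 < c ->
    quadratic_bound_near n k c -> cyc_form k v <= 0 ->
  sqdev v <= 0.
Proof.
move=> n0 k0 v1 c0 /nbhs_equal_ptP[d d0 dU] q0.
have N0 : (0 : R) < n%:R by rewrite ltr0n.
rewrite leNgt; apply/negP => s0.
have M0 : 0 < 200 * n%:R ^+ 2 :> R by rewrite mulr_gt0 // exprn_gt0.
(* The bound would give [c * sqdev v <= 96 * n ^ 2 * t], with 96 = 4 * 24; the last term of the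
   minimum contradicts this, as 200 exceeds 96. *)
pose t := Num.min (1/2) (Num.min (d / 2) (c * sqdev v / (200 * n%:R ^+ 2))).
have cs0 : 0 < c * sqdev v by rewrite mulr_gt0.
have t0 : 0 < t by rewrite !lt_min !divr_gt0.
have t1 : t <= 1/2 by rewrite ge_min lexx.
have t2 : t <= d / 2 by rewrite ge_min [in X in _ || X]ge_min lexx orbT.
have t3 : t * (200 * n%:R ^+ 2) <= c * sqdev v.
  by rewrite -ler_pdivlMr // ge_min [in X in _ || X]ge_min lexx !orbT.
have tv i : `|t * v i| <= t by rewrite normrM gtr0_norm // ler_piMr // ltW.
have xb i : 0 < ray_pt v t ord0 i <= 2.
  by rewrite mxE; have := tv i; rewrite ler_norml => /andP[]; lra.
have U : c * log_dev (ray_pt v t) <= cyc_sum k (ray_pt v t) - n%:R / k%:R.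
  apply: dU => i; last by case/andP: (xb i).
  rewrite mxE addrC addKr; apply: (le_lt_trans (tv i)); lra.
have L : t ^+ 2 * sqdev v <= 2 ^+ 2 * log_dev (ray_pt v t).
  rewrite -(sqdev_affine 1 t v n0).
  have -> : (fun i => 1 + t * v i) = ray_pt v t ord0 by apply/funext => i; rewrite mxE.
  exact: log_dev_ge.
have := @cyc_sum_ray R n k v t k0 v1; rewrite (ltW t0) t1 => /(_ isT).
rewrite ler_norml => /andP[_]; move: U; set D := _ - _ / _ => U B.
have T2 : 0 < t ^+ 2 by rewrite exprn_gt0.
have q1 : t ^+ 2 * cyc_form k v <= 0 by rewrite mulr_ge0_le0 // ltW.
have : t ^+ 2 * (t * (200 * n%:R ^+ 2)) <= t ^+ 2 * (c * sqdev v) by rewrite ler_pM2l.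
have := ler_wpM2l (ltW c0) L.
have : 0 < t ^+ 3 * n%:R ^+ 2 by rewrite mulr_gt0 // exprn_gt0.
lra.
Qed.

Lemma norm_Re_Im_unit_root {R : realType} (n a : nat) :
  `|complex.Re (unit_root R n ^+ a)| <= 1 /\ `|complex.Im (unit_root R n ^+ a)| <= 1.
Proof.
rewrite -expi_unit_root /= !ler_norml.
by rewrite cos_geN1 cos_le1 sin_geN1 sin_le1.
Qed.

(* If [loc_ratio R n k m <= 0], one of the two real waves of frequency [m] is a
   nonconstant direction on which the form is nonpositive. *)
Lemma ex_wave {R : realType} (n k m : nat) :
    (0 < k)%N -> (0 < m < n)%N -> loc_ratio R n k m <= 0 ->
  exists v : 'I_n -> R, [/\ forall i, `|v i| <= 1, 0 < sqdev v,
    cyc_form k v <= 0 & loc_ratio R n k m < 0 -> cyc_form k v < 0].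
Proof.
move=> k0 /andP[m0 mn] r0.
have n0 : (0 < n)%N by exact: leq_trans mn.
have N0 : (0 : R) < n%:R by rewrite ltr0n.
have := @cyc_form_wave R n k m k0.
set c := fun i : 'I_n => complex.Re _; set s := fun i : 'I_n => complex.Im _ => W.
have dev_form (v : 'I_n -> R) : cyc_form k v < 0 -> 0 < sqdev v.
  move=> q; rewrite ltNge; apply/negP => /sqdev_eq0[a va].
  have vE : v = fun=> a by apply/funext.
  by move: q; rewrite vE cyc_form_cst ltxx.
have nr0 : n%:R * loc_ratio R n k m <= 0 by rewrite pmulr_rle0.
(* A sine wave with negative form is nonconstant, as the form vanishes on constants. Otherwise the
   cosine wave is taken, since the sine wave may be identically zero, as for [2 * m = n]. *)
have [s0|s0] := ltP (cyc_form k s) 0.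
  exists s; split=> //; [|exact: dev_form|exact: ltW].
  by move=> i; exact: (norm_Re_Im_unit_root n (m * i)).2.
exists c; split.
- by move=> i; exact: (norm_Re_Im_unit_root n (m * i)).1.
(* If constant, the cosine wave has the same value at positions 0 and 1, which forces
   [unit_root R n ^+ m = 1]. *)
- rewrite ltNge; apply/negP => /sqdev_eq0[a ca].
  have n1 : (1 < n)%N by exact: leq_ltn_trans mn.
  have := @unit_root_neq1 R n m; rewrite m0 mn => /(_ isT)/negP; apply.
  have := ca (Ordinal n1); rewrite -(ca (Ordinal n0)) /c /= muln0 muln1 expr0 /= => E.
  have : complex.Re (unit_root R n ^+ m) ^+ 2 + complex.Im (unit_root R n ^+ m) ^+ 2 = 1.
    by rewrite -expi_unit_root /= cos2Dsin2.
  rewrite E => I1; have /eqP : complex.Im (unit_root R n ^+ m) ^+ 2 = 0 by lra.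
  rewrite sqrf_eq0 => /eqP I0.
  by rewrite eq_complex E I0 !eqxx.
- lra.
- rewrite -(pmulr_rlt0 _ N0); lra.
Qed.

Theorem theorem4p2 (R : realType) (n k : nat) (hn : (2 <= n)%N)
    (hk : (1 <= k <= n - 1)%N) :
  [/\ 0 < Cloc R n k ->
        strict_local_min_mod_scaling R n k /\
        (forall eps : R, 0 < eps -> quadratic_bound_near n k (Cloc R n k - eps)),
      Cloc R n k < 0 ->
        saddle R n k /\ has_below_near R n k
    & Cloc R n k = 0 ->
        ~ exists2 c : R, 0 < c & quadratic_bound_near n k c].
Proof.
have /andP[k0 kn'] := hk.
have n0 : (0 < n)%N by exact: leq_trans hn.
have kn : (0 < k < n)%N by rewrite k0 (leq_ltn_trans kn') // subn1 prednK.
have [m mn CE] := @Cloc_attained R n k hn.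
split=> [C0|C0|C0].
(* This bound yields the strict minimum and, by weakening, the case [eps >= Cloc R n k]. *)
- have half : quadratic_bound_near n k (Cloc R n k / 2).
    have -> : Cloc R n k / 2 = Cloc R n k - Cloc R n k / 2 by field.
    by apply: quadratic_bound_near_Cloc => //; lra.
  split; first by apply: (strict_local_min_of_quadratic_bound _ _ half); rewrite divr_gt0.
  move=> eps e0; have [eC|Ce] := ltP eps (Cloc R n k).
    exact: quadratic_bound_near_Cloc.
  by apply: quadratic_bound_near_weaken half; lra.
- have below : has_below_near R n k.
    have [|v [v1 _ _ q]] := @ex_wave R n k m k0 mn; first by rewrite -CE ltW.
    have {}q : cyc_form k v < 0 by apply: q; rewrite -CE.
    move=> U /(cyc_sum_sign_near v n0 k0 v1 (ltr0_neq0 q))[x [Ux xp xq]].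
    by exists x; split=> //; move: xq; rewrite nmulr_lgt0 // subr_lt0.
  split=> //; split=> //; first exact: critical_equal_pt.
  have q := @cyc_form_delta_gt0 R n k (Ordinal n0) kn.
  move=> U /(cyc_sum_sign_near _ n0 k0 _ (lt0r_neq0 q))[|x [Ux xp xq]].
    by move=> i; case: ifP; rewrite ?normr1 ?normr0.
  by exists x; split=> //; move: xq; rewrite pmulr_lgt0 // subr_gt0.
- move=> [c c0 B].
  have [|v [v1 s q _]] := @ex_wave R n k m k0 mn; first by rewrite -CE C0.
  by have := quadratic_bound_near_form c v n0 k0 v1 c0 B q; rewrite leNgt s.
Qed.
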